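(* Let $q\in[1,\infty)$ and let $\boldsymbol p=(p(j))_{j\ge1}$ be a sequence with $p(j)\in[0,\frac12]$ and $p(j)\ge p(j+1)$ for all $j\ge1$. Then $\lim_{n\to\infty}\mathbb E\|\hat{\boldsymbol p}_n-\boldsymbol p\|_q=0$ if and only if $\|\boldsymbol p\|_1<\infty$. Moreover, if $\|\boldsymbol p\|_1=\infty$, then $\|\hat{\boldsymbol p}_n-\boldsymbol p\|_q=\infty$ almost surely.
   Context: $\|x\|_q=(\sum_{j\ge1}|x(j)|^q)^{1/q}\in[0,\infty]$. $\hat{\boldsymbol p}_n=\frac1n\sum_{i=1}^nX_i$ where $X_1,\dots,X_n$ are i.i.d. samples from the product distribution on $\{0,1\}^{\mathbb N}$ whose coordinates are independent Bernoulli variables with parameters $p(j)$; the last assertion is for every $n\ge1$. *)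

(* Defs.v *)
From mathcomp Require Export all_boot all_order all_algebra.
From mathcomp Require Export finmap.
From mathcomp Require Export all_classical all_reals all_analysis.

Set Implicit Arguments.
Unset Strict Implicit.
Unset Printing Implicit Defensive.

Import Order.TTheory GRing.Theory Num.Theory.
Import numFieldNormedType.Exports.

Local Open Scope classical_set_scope.
Local Open Scope ring_scope.

(* Sequences indexed by j >= 1 (and samples X_1, X_2, ...) are indexed by nat
   from 0: [x j] stands for the entry of rank j + 1. *)

Definition lq_norm (R : realType) (q : R) (x : nat -> R) : \bar R :=
  'N[@counting nat R]_(q%:E)[EFin \o x].

Lemma lq_normE (R : realType) (q : R) (x : nat -> R) : 0 < q ->
  lq_norm q x = ((\sum_(0 <= j <oo) (`|x j| `^ q)%:E) `^ q^-1)%E.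
Proof. by move=> q0; rewrite /lq_norm Lnorm_counting. Qed.

(* {0,1}^N with its product sigma-algebra, generated by the coordinates. *)
Definition coord_events : set (set (nat -> bool)) :=
  [set A | exists j (B : set bool), A = [set x | B (x j)]].

Notation bitseqs := (g_sigma_algebraType coord_events).

(* mu is the product over j of the Bernoulli(p j) laws: its value on a
   finite-dimensional rectangle is the product of the marginal
   probabilities. This determines mu. *)
Definition is_product_bernoulli (R : realType) (p : nat -> R)
    (mu : probability bitseqs R) : Prop :=
  forall (J : {fset nat}) (B : nat -> set bool),
    mu (\bigcap_(j in [set` J]) [set x : nat -> bool | B j (x j)]) =
    (\prod_(j <- J) bernoulli_prob (p j) (B j))%E.

Definition mutually_independent (R : realType) (d d' : measure_display)
    (T : measurableType d) (S : measurableType d') (P : probability T R)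
    (I : choiceType) (X : I -> {RV P >-> S}) : Prop :=
  forall (J : {fset I}) (A : I -> set S), (forall i, measurable (A i)) ->
    P (\bigcap_(i in [set` J]) (X i @^-1` A i)) =
    (\prod_(i <- J) P (X i @^-1` A i))%E.

Definition iid_samples (R : realType) (d d' : measure_display)
    (T : measurableType d) (S : measurableType d') (P : probability T R)
    (mu : probability S R) (X : nat -> {RV P >-> S}) : Prop :=
  mutually_independent X /\
  forall i (A : set S), measurable A -> distribution P (X i) A = mu A.

Definition empirical_mean (R : realType) (d : measure_display)
    (T : measurableType d) (P : probability T R)
    (X : nat -> {RV P >-> bitseqs}) (n : nat) (w : T) : nat -> R :=
  fun j => n%:R^-1 * \sum_(i < n) ((X i w : nat -> bool) j)%:R.

(* Main.v *)
Require Import Defs.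
From mathcomp Require Import measurable_realfun ring lra.
Import Order.TTheory GRing.Theory Num.Theory.
Import numFieldNormedType.Exports.
Local Open Scope classical_set_scope.
Local Open Scope ring_scope.

(* If [\sum_j p j] is finite, then [||D||_q <= ||D||_1] for the deviation [D] of
   the empirical mean, and [\sum_j E|D j|] tends to 0 by dominated convergence
   for the counting measure: [E|D j| <= 2 p j], and the variance bound gives
   [E|D j| <= (1 + p j) / sqrt n].
   If the sum diverges, the second Borel-Cantelli lemma yields almost surely
   infinitely many coordinates [j] with [|D j|] bounded below: when [p j >= c > 0]
   for all [j], those where all [n] bits vanish, so that [|D j| = p j >= c];
   otherwise [p j < (2 n)^-1] eventually, and those where the first bit is 1, so
   that [|D j| >= n^-1 - p j >= (2 n)^-1]. *)

(** * Comparison, divergence and measurability of $\ell^q$ norms *)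

Section lq_norm.
Context (R : realType).
Implicit Types (q : R) (x : nat -> R).

Lemma lq_norm1 x : lq_norm 1 x = (\sum_(0 <= j <oo) `|x j|%:E)%E.
Proof.
rewrite lq_normE// invr1 poweRe1; last first.
  by apply: nneseries_ge0 => j _ _; rewrite lee_fin powR_ge0.
by apply: eq_eseriesr => j _; rewrite powRr1.
Qed.

(** Let [s] be the 1-norm, assumed finite. Each [|x j|] is at most [s], so [|x j|^q = |x j|^(q-1) |x
    j| <= s^(q-1) |x j|]; summing over [j] gives at most [s^q]. *)
Lemma lq_norm_le_lq_norm1 q x : 1 <= q -> (lq_norm q x <= lq_norm 1 x)%E.
Proof.
move=> q1; have q0 : 0 < q by lra.
rewrite lq_norm1; set s := (\sum_(0 <= j <oo) `|x j|%:E)%E.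
have s0 : (0 <= s)%E by apply: nneseries_ge0 => j _ _; rewrite lee_fin.
have [->|sy] := eqVneq s +oo%E; first by rewrite leey.
have sf : s \is a fin_num by rewrite ge0_fin_numE// lt_neqAle sy leey.
have xs j : `|x j| <= fine s.
  rewrite -lee_fin fineK//.
  apply: le_trans (nneseries_lim_ge j.+1 _) => [|i _ _]; last by rewrite lee_fin.
  rewrite big_nat_recr//= leeDr// sume_ge0// => i _; exact: lee_tofin.
have fs0 : 0 <= fine s by exact: fine_ge0.
suff : (\sum_(0 <= j <oo) (`|x j| `^ q)%:E <= (fine s `^ q)%:E)%E.
  move=> H; rewrite lq_normE// -(fineK sf).
  have -> : fine s = (fine s `^ q) `^ q^-1 by rewrite -powRrM mulfV ?gt_eqF// powRr1.
  rewrite -poweR_EFin; apply: gt0_ler_poweR; rewrite ?in_itv/= ?leey ?andbT//.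
  - by rewrite invr_ge0 ltW.
  - by apply: nneseries_ge0 => j _ _; rewrite lee_fin powR_ge0.
  - by rewrite lee_fin powR_ge0.
rewrite -mulr_powRB1// mulrC EFinM fineK//.
rewrite -nneseriesZl; last by move=> i _; rewrite lee_fin.
apply: lee_nneseries => [i _ _|i _]; first by rewrite lee_fin powR_ge0.
rewrite -EFinM lee_fin -mulr_powRB1// mulrC ler_wpM2r//.
by apply: ge0_ler_powR; rewrite ?nnegrE// subr_ge0.
Qed.

(** Every marked index from [N] on contributes at least [e^q], and discarding the first [N] indices
    removes only finitely many marks. *)
Lemma lq_norm_pinfty q x (b : nat -> bool) N (e : R) : 0 < q -> 0 < e ->
  (\sum_(0 <= j <oo) (b j)%:R%:E = +oo :> \bar R)%E ->
  (forall j, (N <= j)%N -> b j -> e <= `|x j|) -> lq_norm q x = +oo%E.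
Proof.
move=> q0 e0 by_ bx; rewrite lq_normE//.
suff -> : (\sum_(0 <= j <oo) (`|x j| `^ q)%:E = +oo)%E.
  by apply: eqy_poweR; rewrite ?invr_gt0.
have eq0 : 0 < e `^ q by rewrite powR_gt0.
have b0 j : (0 <= (b j)%:R%:E :> \bar R)%E by rewrite lee_fin.
have bNy : (\sum_(N <= j <oo) (b j)%:R%:E = +oo :> \bar R)%E.
  move: by_; rewrite (nneseries_split 0 N)// add0n sumEFin.
  by case: (\sum_(N <= j <oo) _)%E.
apply/eqP; rewrite -leye_eq.
rewrite (nneseries_split 0 N) => [|j _]; last by rewrite lee_fin powR_ge0.
apply: le_trans (leeDr _ _); last first.
  by apply: sume_ge0 => j _; rewrite lee_fin powR_ge0.
rewrite add0n; apply: (@le_trans _ _ (\sum_(N <= j <oo) ((e `^ q)%:E * (b j)%:R%:E))%E).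
  by rewrite nneseriesZl// bNy gt0_muley.
(* Both tails are reindexed from 0, so that the new index [j + N] satisfies the bound [N <= j + N]
   by itself. *)
rewrite -[leLHS]nneseries_addn; last by move=> j; rewrite mule_ge0// lee_fin ltW.
rewrite -[leRHS]nneseries_addn; last by move=> j; rewrite lee_fin powR_ge0.
apply: lee_nneseries => [j _ _|j _]; first by rewrite mule_ge0// lee_fin ltW.
have [bj|_] := boolP (b _); last by rewrite mule0 lee_fin powR_ge0.
rewrite mule1 lee_fin; apply: ge0_ler_powR; rewrite ?nnegrE//; [exact: ltW..|].
by apply: bx => //; rewrite leq_addl.
Qed.

Lemma measurable_lq_norm (d : measure_display) (T : measurableType d) q
    (f : nat -> T -> R) : 0 < q -> (forall j, measurable_fun setT (f j)) ->
  measurable_fun setT (fun w => lq_norm q (f ^~ w)).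
Proof.
move=> q0 mf; under eq_fun do rewrite lq_normE//.
apply: (measurableT_comp (measurable_poweR _)).
apply: ge0_emeasurable_sum => [j w _ _|j _]; first by rewrite lee_fin powR_ge0.
apply/measurable_EFinP/(measurableT_comp (measurable_powR _)).
exact: measurableT_comp.
Qed.

End lq_norm.

(** * Variance bound and second Borel-Cantelli lemma under pairwise independence *)

Section pairwise_independent_events.
Context (d : measure_display) (T : measurableType d) (R : realType).
Variables (P : probability T R) (A : nat -> set T) (a : nat -> R).
Hypothesis mA : forall i, measurable (A i).
Hypothesis PA : forall i, P (A i) = (a i)%:E.
Hypothesis PAI : forall i j, i != j -> P (A i `&` A j) = (a i * a j)%:E.

Let S n w : R := \sum_(i < n) \1_(A i) w.
Let m n : R := \sum_(i < n) a i.

Let a_ge0 i : 0 <= a i.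
Proof. by rewrite -lee_fin -PA measure_ge0. Qed.

Let m_ge0 n : 0 <= m n.
Proof. by apply: sumr_ge0 => i _; exact: a_ge0. Qed.

Let S_ge0 n w : 0 <= S n w.
Proof. by apply: sumr_ge0 => i _; rewrite indicE. Qed.

Let mS n : measurable_fun setT (S n).
Proof. by apply: measurable_sum => i; exact: measurable_indic. Qed.

Let int_indic (B : set T) : measurable B -> (\int[P]_w (\1_B w)%:E = P B)%E.
Proof. by move=> mB; rewrite integral_indic// setIT. Qed.

(** In the expansion of [S n ^ 2] over pairs, a diagonal pair has mean [a i], bounded by
    [a i + a i ^ 2], and any other pair has mean [a i * a j]. Hence the second moment is at most
    [m n + m n ^ 2], which exceeds the squared mean by [m n]. *)
Lemma variance_sum_indic_le n :
  (\int[P]_w ((S n w - m n) ^+ 2)%:E <= (m n)%:E)%E.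
Proof.
have mV : measurable_fun setT (fun w => ((S n w - m n) ^+ 2)%:E).
  by apply/measurable_EFinP/measurable_funX/measurable_funB.
have IS : (\int[P]_w (S n w)%:E = (m n)%:E)%E.
  under eq_integral do rewrite /S -sumEFin.
  rewrite ge0_integral_sum//.
  - rewrite /m -sumEFin; apply: eq_bigr => i _.
    by rewrite int_indic// PA.
  - by move=> i; apply/measurable_EFinP; exact: measurable_indic.
have ISS : (\int[P]_w (S n w * S n w)%:E <= (m n + m n ^+ 2)%:E)%E.
  have -> : (\int[P]_w (S n w * S n w)%:E =
      \int[P]_w (\sum_(i < n) \sum_(j < n) (\1_(A i `&` A j) w)%:E))%E.
    apply: eq_integral => w _; rewrite /S mulr_suml -sumEFin.
    apply: eq_bigr => i _; rewrite mulr_sumr -sumEFin.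
    by apply: eq_bigr => j _; rewrite indicI.
  rewrite ge0_integral_sum//; last 2 first.
  - move=> i; apply: emeasurable_sum => j; apply/measurable_EFinP.
    exact/measurable_indic/measurableI.
  - by move=> i w _; apply: sume_ge0 => j _; rewrite lee_fin indicE.
  have -> : m n + m n ^+ 2 = \sum_(i < n) (a i + \sum_(j < n) a i * a j).
    rewrite big_split/= expr2 {2}/m mulr_suml; congr (_ + _).
    by apply: eq_bigr => i _; rewrite mulr_sumr.
  rewrite -sumEFin; apply: lee_sum => i _.
  rewrite ge0_integral_sum//; last first.
    by move=> j; apply/measurable_EFinP/measurable_indic/measurableI.
  rewrite (bigD1 i)//= [in leRHS](bigD1 i)//=.
  rewrite int_indic; last exact: measurableI.
  rewrite setIid PA addrA EFinD; apply: leeD.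
    by rewrite lee_fin lerDl mulr_ge0.
  rewrite -sumEFin; apply: lee_sum => j ji.
  rewrite int_indic; last exact: measurableI.
  by rewrite PAI// eq_sym.
have m2 : 0 <= 2 * m n by rewrite mulr_ge0.
(* The expansion of the square is stated additively: all integrands are then nonnegative, and the
   integral is additive without integrability conditions. *)
have : (\int[P]_w ((S n w - m n) ^+ 2)%:E + (2 * m n * m n)%:E =
        \int[P]_w (S n w * S n w)%:E + (m n ^+ 2)%:E)%E.
  rewrite [(2 * m n * m n)%:E]EFinM -[in LHS]IS -ge0_integralZl//; last 2 first.
  - by apply/measurable_EFinP; exact: mS.
  - by move=> w _; rewrite lee_fin.
  have -> : ((m n ^+ 2)%:E = \int[P]_w (m n ^+ 2)%:E)%E.
    by rewrite integral_cst// [X in (_ * X)%E]probability_setT mule1.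
  rewrite -!ge0_integralD//.
  - by apply: eq_integral => w _; rewrite -EFinM -!EFinD; congr EFin; ring.
  - by move=> w _; rewrite lee_fin mulr_ge0.
  - by apply/measurable_EFinP/measurable_funM; exact: mS.
  - by move=> w _; rewrite lee_fin sqr_ge0.
  - by move=> w _; rewrite lee_fin sqr_ge0.
  - by move=> w _; rewrite mule_ge0// lee_fin.
  - apply: measurable_funeM; apply/measurable_EFinP; exact: mS.
move: ISS; set I := (\int[P]_w ((S n w - m n) ^+ 2)%:E)%E.
set J := (\int[P]_w (S n w * S n w)%:E)%E => JE IJ.
have := leeD JE (lexx (m n ^+ 2)%:E); rewrite -IJ -EFinD.
rewrite -leeBrDr// -EFinB => /le_trans; apply.
rewrite lee_fin; lra.
Qed.

(** The exceptional set is the countable union of the sets [B k] on which at most [k] of the events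
    occur. Chebyshev's inequality bounds [P (B k) * m n] by a constant once [m n] is large, while
    [m n] is unbounded; so each [B k] is null. *)
Lemma borel_cantelli2 : (\sum_(0 <= i <oo) (a i)%:E = +oo)%E ->
  {ae P, forall w, (\sum_(0 <= i <oo) (\1_(A i) w : R)%:E = +oo)%E}.
Proof.
move=> dv.
have SE n w : (\sum_(0 <= i < n) (\1_(A i) w : R)%:E = (S n w)%:E)%E.
  by rewrite big_mkord sumEFin.
have mdv (M : R) : exists n, M <= m n.
  have : (\sum_(0 <= i < n) (a i)%:E @[n --> \oo] --> +oo)%E.
    by rewrite -dv; apply: is_cvg_nneseries => n _ _; rewrite lee_fin.
  move=> /cvgeyPge /(_ M)[N _ /(_ N (leqnn _))] /=.
  by rewrite big_mkord sumEFin lee_fin; exists N.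
pose B k := [set w | (\sum_(0 <= i <oo) (\1_(A i) w : R)%:E <= k%:R%:E)%E].
apply: (@negligibleS _ _ _ _ (\bigcup_k B k)).
  move=> w /= /eqP; rewrite -ltey.
  have : (0 <= \sum_(0 <= i <oo) (\1_(A i) w : R)%:E)%E.
    by apply: nneseries_ge0 => i _ _; rewrite lee_fin indicE.
  move=> s0 sy; have sf : (\sum_(0 <= i <oo) (\1_(A i) w : R)%:E)%E \is a fin_num.
    by rewrite ge0_fin_numE.
  exists (Num.trunc (fine (\sum_(0 <= i <oo) (\1_(A i) w : R)%:E)%E)).+1 => //.
  by rewrite /B /= -[leLHS]fineK// lee_fin ltW// truncnS_gt.
apply: negligible_bigcup => k.
have mB : measurable (B k).
  rewrite -[B k]setTI; apply: emeasurable_fun_infty_c => //.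
  apply: ge0_emeasurable_sum => [i w _ _|i _]; first by rewrite lee_fin indicE.
  by apply/measurable_EFinP; exact: measurable_indic.
apply/negligibleP => //; have [//|PB0] := eqVneq (P (B k)) 0%E.
have PBf : P (B k) \is a fin_num by exact: fin_num_measure.
have SB n w : B k w -> S n w <= k%:R.
  move=> Bw; rewrite -lee_fin -SE; apply: le_trans Bw.
  by apply: nneseries_lim_ge => i _ _; rewrite lee_fin indicE.
(* Chebyshev: S n <= k on B k, while S n has mean m n and variance at most m n. *)
have cheb n : 2 * k%:R <= m n -> (P (B k) * (m n)%:E <= 4%:E)%E.
  move=> kmn; have [mn0|mn0] := eqVneq (m n) 0; first by rewrite mn0 mule0.
  have {}mn0 : 0 < m n by rewrite lt_neqAle eq_sym mn0 /=.
  suff : (P (B k) * ((m n / 2) ^+ 2)%:E <= (m n)%:E)%E.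
    rewrite -(fineK PBf) -!EFinM !lee_fin => H.
    rewrite -(ler_pM2r mn0); nra.
  apply: le_trans (variance_sum_indic_le n).
  rewrite muleC -int_indic// -ge0_integralZl//; last 2 first.
  - by apply/measurable_EFinP; exact: measurable_indic.
  - by rewrite lee_fin sqr_ge0.
  apply: ge0_le_integral => //.
  - by move=> w _; rewrite mule_ge0// lee_fin ?sqr_ge0// indicE.
  - apply: measurable_funeM; apply/measurable_EFinP; exact: measurable_indic.
  - by apply/measurable_EFinP/measurable_funX/measurable_funB.
  move=> w _; rewrite indicE; have [wB|wB] := boolP (w \in B k).
    rewrite mule1 lee_fin; move: wB; rewrite inE => /(SB n); nra.
  by rewrite mule0 lee_fin sqr_ge0.
have b0 : 0 < fine (P (B k)).
  by rewrite -lte_fin fineK// lt_neqAle eq_sym PB0 measure_ge0.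
exfalso.
(* The first summand makes [cheb] applicable; the second forces [P (B k) * m n >= 5], against the
   bound 4. *)
have [n] := mdv (2 * k%:R + 5 / fine (P (B k))).
have : 0 < 5 / fine (P (B k)) by rewrite divr_gt0.
have k0 : 0 <= k%:R :> R by [].
move=> b5 mn; have := cheb n; rewrite -(fineK PBf) -EFinM lee_fin.
move=> /(_ ltac:(lra)); apply/negP; rewrite -ltNge.
have : fine (P (B k)) * (5 / fine (P (B k))) = 5 by rewrite mulrCA divff ?mulr1// gt_eqF.
nra.
Qed.
End pairwise_independent_events.

(** * Probabilities of coordinate events for the samples *)

Section product_sample.
Context (d : measure_display) (T : measurableType d) (R : realType).
Variables (p : nat -> R) (P : probability T R) (mu : probability bitseqs R).
Variable X : nat -> {RV P >-> bitseqs}.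
Hypothesis p_range : forall j, 0 <= p j <= 2^-1.
Hypothesis mu_prod : is_product_bernoulli p mu.
Hypothesis X_iid : iid_samples mu X.

Let coord (b : bool) j : set bitseqs := [set x : nat -> bool | x j = b].

Let pb (b : bool) j : R := if b then p j else 1 - p j.

Let measurable_coord b j : measurable (coord b j).
Proof. by apply: sub_sigma_algebra; exists j, [set b]. Qed.

Let bernoulli_pb b j : bernoulli_prob (p j) [set b] = (pb b j)%:E.
Proof.
rewrite bernoulli_probE; last by have := p_range j; lra.
have E c : (c \in [set b]) = (c == b) by apply/idP/eqP; rewrite inE.
rewrite !diracE !E /pb.
by case: b {E} => /=; rewrite ?mule1 ?mule0 ?adde0 ?add0e.
Qed.

Let mu_coord b j : mu (coord b j) = (pb b j)%:E.
Proof.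
have := mu_prod [fset j]%fset (fun=> [set b]).
rewrite big_seq_fset1 bernoulli_pb => <-; congr (mu _).
apply/seteqP; split => [x xj i|x]; first by rewrite /= inE => /eqP ->.
by apply; rewrite /= inE.
Qed.

Let mu_coordI b j k : j != k ->
  mu (coord b j `&` coord b k) = (pb b j * pb b k)%:E.
Proof.
move=> jk; have := mu_prod [fset j; k]%fset (fun=> [set b]).
rewrite big_fsetU1 ?inE//= big_seq_fset1 !bernoulli_pb -EFinM => <-; congr (mu _).
apply/seteqP; split => [x [xj xk] i|x].
  by rewrite /= !inE => /orP[] /eqP ->.
by move=> H; split; apply: H; rewrite /= !inE eqxx ?orbT.
Qed.

Let P_preimage C i : measurable C -> P (X i @^-1` C) = mu C.
Proof. by case: X_iid => _ H mC; rewrite -(H i). Qed.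

Let measurable_preimage C i : measurable C -> measurable (X i @^-1` C).
Proof. by move=> mC; rewrite -[_ @^-1` _]setTI; exact: measurable_funPT. Qed.

Let P_preimageI C i k r : measurable C -> mu C = r%:E -> i != k ->
  P (X i @^-1` C `&` X k @^-1` C) = (r * r)%:E.
Proof.
move=> mC Cr ik; have := (proj1 X_iid) [fset i; k]%fset (fun=> C) (fun=> mC).
rewrite big_fsetU1 ?inE//= big_seq_fset1 !P_preimage// Cr -EFinM => <-.
congr (P _); apply/seteqP; split => [x [xi xk] j|x].
  by rewrite /= !inE => /orP[] /eqP ->.
by move=> H; split; apply: H; rewrite /= !inE eqxx ?orbT.
Qed.

(** The event [C] is left general: it serves both for one coordinate and for the intersection of
    two, which yields pairwise independence of the blocks. *)
Let P_block m C r : measurable C -> mu C = r%:E ->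
  P (\bigcap_(i in `I_m) X i @^-1` C) = (r ^+ m)%:E.
Proof.
move=> mC Cr; have := (proj1 X_iid) [fset i in iota 0 m]%fset (fun=> C) (fun=> mC).
under eq_bigr do rewrite P_preimage// Cr.
rewrite big_const_seq count_predT card_fseq undup_id ?iota_uniq// size_iota.
have -> : iter m (mule r%:E) 1%E = (r ^+ m)%:E.
  by elim: m => //= m ->; rewrite -EFinM exprS.
move=> <-; congr (P _); apply/seteqP; split => x H i /=.
  by rewrite inE mem_iota => im; exact: H.
by move=> im; apply: H; rewrite /= inE mem_iota.
Qed.

(** Two cases are used: [block false n j], where the empirical mean of [n] samples vanishes at [j],
    and [block true 1 j], where it is at least [n^-1]. *)
Let block (b : bool) m j := \bigcap_(i in `I_m) X i @^-1` coord b j.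

(** For [j != k] the intersection of two blocks is again a block, over [coord b j] intersected with
    [coord b k]; its probability [(pb b j * pb b k)^m] is the product of the two, so the second
    Borel-Cantelli lemma applies. *)
Lemma ae_block_infinitely_often b m : (\sum_(0 <= j <oo) (pb b j ^+ m)%:E = +oo)%E ->
  {ae P, forall w, (\sum_(0 <= j <oo) (\1_(block b m j) w : R)%:E = +oo)%E}.
Proof.
apply: borel_cantelli2.
- by move=> j; apply: bigcap_measurableType => // i _; exact: measurable_preimage.
- by move=> j; exact: P_block.
- move=> j k jk; rewrite -exprMn /block -bigcapI.
  apply: (P_block m (coord b j `&` coord b k)).
    exact: measurableI.
  exact: mu_coordI.
Qed.

(** * Mean absolute deviation of the empirical mean, coordinate by coordinate *)

Let dev n j w := empirical_mean X n w j - p j.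

Let p_ge0 j : 0 <= p j.
Proof. by have := p_range j; lra. Qed.

Let devE n j w :
  dev n j w = n%:R^-1 * (\sum_(i < n) \1_(X i @^-1` coord true j) w) - p j.
Proof.
congr (_ * _ - _); apply: eq_bigr => i _; rewrite indicE; congr (_%:R).
by apply: congr1; apply/idP/idP; rewrite inE.
Qed.

Lemma measurable_dev n j : measurable_fun setT (dev n j).
Proof.
rewrite (funext (devE n j)).
apply: measurable_funB => //; apply: measurable_funM => //.
apply: measurable_sum => i; apply: measurable_indic.
exact: measurable_preimage.
Qed.

Let measurable_absdev n j : measurable_fun setT (fun w => `|dev n j w|%:E).
Proof. by apply/measurable_EFinP/measurableT_comp => //; exact: measurable_dev. Qed.

(** Triangle inequality: the empirical mean and [p j] each contribute at most [p j]. The bound is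
    uniform in [n], as a dominating function requires. *)
Lemma mean_abs_dev_le n j : (\int[P]_w `|dev n j w|%:E <= (2 * p j)%:E)%E.
Proof.
have mX i : measurable_fun setT (fun w => (\1_(X i @^-1` coord true j) w : R)%:E).
  by apply/measurable_EFinP/measurable_indic/measurable_preimage.
apply: (@le_trans _ _ (\int[P]_w (n%:R^-1%:E *
    (\sum_(i < n) (\1_(X i @^-1` coord true j) w)%:E) + (p j)%:E))%E).
  apply: ge0_le_integral => //.
  - by apply: emeasurable_funD => //; apply: measurable_funeM; exact: emeasurable_sum.
  - move=> w _; rewrite devE sumEFin -EFinM -EFinD lee_fin.
    apply: (le_trans (ler_normB _ _)); rewrite (ger0_norm (p_ge0 j)) ger0_norm//.
    by rewrite mulr_ge0// sumr_ge0.
rewrite ge0_integralD//; last 3 first.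
- by move=> w _; rewrite mule_ge0// sume_ge0.
- by apply: measurable_funeM; exact: emeasurable_sum.
- by move=> w _; rewrite lee_fin.
rewrite integral_cst// [X in (_ * X)%E]probability_setT mule1.
rewrite ge0_integralZl//; last 2 first.
- exact: emeasurable_sum.
- by move=> w _; rewrite sume_ge0.
rewrite ge0_integral_sum//.
have E i : (\int[P]_w (\1_(X i @^-1` coord true j) w)%:E = (p j)%:E)%E.
  rewrite integral_indic//; last exact: measurable_preimage.
  by rewrite setIT [LHS]P_preimage// mu_coord.
under eq_bigr do rewrite E.
rewrite sumEFin sumr_const card_ord -EFinM -EFinD lee_fin.
(* For [n = 0] the empirical mean is 0, and only [p j <= 2 * p j] remains. *)
have [->|n0] := eqVneq n 0%N; first by rewrite mulr0n mulr0; have := p_ge0 j; lra.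
rewrite -[p j *+ n]mulr_natl mulrA mulVf ?pnatr_eq0// mul1r /pb; lra.
Qed.

(* With s = sqrt n, AM-GM gives |D| <= (s^-1 + s D^2) / 2. *)
Lemma mean_abs_dev_le_sqrt n j : (0 < n)%N ->
  (\int[P]_w `|dev n j w|%:E <= ((Num.sqrt n%:R)^-1 * (1 + p j))%:E)%E.
Proof.
move=> n0; set s : R := Num.sqrt n%:R.
have s0 : 0 < s by rewrite sqrtr_gt0 ltr0n.
have s2 : s ^+ 2 = n%:R by rewrite sqr_sqrtr.
have sV : s * s^-1 = 1 by rewrite divff ?gt_eqF.
have sV0 : 0 < s^-1 by rewrite invr_gt0.
pose S w : R := \sum_(i < n) \1_(X i @^-1` coord true j) w.
have mS : measurable_fun setT S.
  by apply: measurable_sum => i; exact/measurable_indic/measurable_preimage.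
have V : (\int[P]_w ((S w - \sum_(i < n) p j) ^+ 2)%:E <= (\sum_(i < n) p j)%:E)%E.
  apply: (@variance_sum_indic_le _ _ _ P (fun i => X i @^-1` coord true j) (fun=> p j)).
  - by move=> i; exact: measurable_preimage.
  - by move=> i; rewrite P_preimage// mu_coord.
  - by move=> i k ik; apply: P_preimageI => //; rewrite mu_coord.
apply: (@le_trans _ _ (\int[P]_w (s^-1%:E +
    (s * n%:R ^- 2)%:E * ((S w - \sum_(i < n) p j) ^+ 2)%:E))%E).
  apply: ge0_le_integral => //.
  - apply: emeasurable_funD => //; apply: measurable_funeM.
    by apply/measurable_EFinP/measurable_funX/measurable_funB.
  - move=> w _; rewrite -EFinM -EFinD lee_fin devE -/(S w).
    rewrite sumr_const card_ord -[p j *+ n]mulr_natl.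
    have nV : n%:R * n%:R^-1 = 1 :> R by rewrite divff// pnatr_eq0 -lt0n.
    set D := _ - _.
    have -> : s * n%:R ^- 2 * (S w - n%:R * p j) ^+ 2 = s * D ^+ 2.
      rewrite -exprVn -mulrA -exprMn /D; congr (_ * _ ^+ 2); rewrite mulrBr mulrA.
      by rewrite [X in _ - X * _]mulrC nV mul1r.
    rewrite -(real_normK (num_real D)); move: (normr_ge0 D); set x := `|D|.
    (* Nonnegativity of [(s x - 1/2)^2] gives [s x <= s^2 x^2 + 1/4], which is stronger than the
       bound needed. *)
    rewrite -(ler_pM2l s0) mulrDr sV; have := sqr_ge0 (s * x - 2^-1); nra.
have mV : measurable_fun setT (fun w => ((S w - \sum_(i < n) p j) ^+ 2)%:E).
  by apply/measurable_EFinP/measurable_funX/measurable_funB.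
have sn0 : 0 <= s * n%:R ^- 2 by rewrite mulr_ge0 ?invr_ge0 ?exprn_ge0// ltW.
rewrite ge0_integralD//; last 3 first.
- by move=> w _; rewrite lee_fin ltW.
- by move=> w _; rewrite mule_ge0// lee_fin sqr_ge0.
- exact: measurable_funeM.
rewrite integral_cst// [X in (_ * X)%E]probability_setT mule1.
rewrite ge0_integralZl//; last by move=> w _; rewrite lee_fin sqr_ge0.
apply: (@le_trans _ _ (s^-1%:E + (s * n%:R ^- 2)%:E * (\sum_(i < n) p j)%:E)%E).
  by rewrite leeD2l// lee_wpmul2l// lee_fin.
(* With [n = s^2] the variance term is [s * s^-4 * s^2 * p j = s^-1 * p j]. *)
rewrite sumr_const card_ord -[p j *+ n]mulr_natl -EFinM -EFinD lee_fin -s2.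
rewrite [leLHS](_ : _ = s^-1 * (1 + p j))//; field; rewrite gt_eqF//.
Qed.

Lemma cvg_mean_abs_dev j : (\int[P]_w `|dev n j w|%:E)%E @[n --> \oo] --> 0%E.
Proof.
have sqrty : (Num.sqrt n%:R : R) @[n --> \oo] --> +oo.
  apply/cvgryPge => A; near=> n.
  have [A0|A0] := leP A 0; first by rewrite (le_trans A0)// sqrtr_ge0.
  rewrite -(ler_sqr) ?nnegrE ?sqrtr_ge0 ?(ltW A0)// sqr_sqrtr//.
  by near: n; exact: nbhs_infty_ger.
apply: (@squeeze_cvge _ _ _ _ (cst 0%E) _
    (fun n => ((Num.sqrt n%:R)^-1 * (1 + p j))%:E)).
- near=> n; rewrite integral_ge0//=; apply: mean_abs_dev_le_sqrt.
  by near: n; exact: nbhs_infty_gt.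
- exact: cvg_cst.
- apply: cvg_EFin; first by apply: nearW.
  rewrite /comp/= -[X in _ --> X](mul0r (1 + p j)).
  apply: cvgM; last exact: cvg_cst.
  apply/gtr0_cvgV0 => //; near=> n; rewrite sqrtr_gt0 ltr0n.
  by near: n; exact: nbhs_infty_gt.
Unshelve. all: by end_near. Qed.

Lemma cvg_mean_lq_norm_dev q : 1 <= q -> (lq_norm 1 p < +oo)%E ->
  (\int[P]_w lq_norm q (dev n ^~ w))%E @[n --> \oo] --> 0%E.
Proof.
move=> q1 py; have q0 : 0 < q by lra.
have py2 : (\sum_(0 <= j <oo) (p j)%:E < +oo)%E.
  by move: py; rewrite lq_norm1; under eq_eseriesr do rewrite ger0_norm//.
(* Tonelli exchanges sum and expectation. The sum is written as an integral for the counting measure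
   so that dominated convergence applies to it. *)
have ub n : (\int[P]_w lq_norm q (dev n ^~ w) <=
    \int[@counting nat R]_j \int[P]_w `|dev n j w|%:E)%E.
  rewrite ge0_integral_count; last by move=> j; apply: integral_ge0.
  rewrite -integral_nneseries//.
  apply: ge0_le_integral => //.
  - by move=> w _; exact: Lnorm_ge0.
  - by apply: measurable_lq_norm => // j; exact: measurable_dev.
  - by apply: ge0_emeasurable_sum.
  - move=> w _; apply: le_trans (lq_norm_le_lq_norm1 _ _ _ q1) _.
    by rewrite lq_norm1.
apply: (@squeeze_cvge _ _ _ _ (cst 0%E) _
    (fun n => \int[@counting nat R]_j \int[P]_w `|dev n j w|%:E)%E).
- by apply: nearW => n; rewrite ub andbT; apply: integral_ge0 => w _; exact: Lnorm_ge0.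
- exact: cvg_cst.
rewrite -[X in _ --> X](integral0 (@counting nat R) setT).
apply: (@dominated_cvg _ _ _ _ _ _ _ _ (fun j => (2 * p j)%:E)) => //.
- by move=> j _; exact: cvg_mean_abs_dev.
- apply/integrableP; split => //.
  rewrite ge0_integral_count//.
  under eq_eseriesr do rewrite gee0_abs ?lee_fin ?mulr_ge0// EFinM.
  rewrite nneseriesZl; last by move=> j _; rewrite lee_fin.
  by apply: lte_mul_pinfty => //; rewrite lee_fin.
- move=> n j _; rewrite gee0_abs; first exact: mean_abs_dev_le.
  by apply: integral_ge0.
Qed.

Lemma ae_lq_norm_dev_pinfty q n : 0 < q -> (0 < n)%N ->
  (forall j, p j.+1 <= p j) -> lq_norm 1 p = +oo%E ->
  {ae P, forall w, lq_norm q (dev n ^~ w) = +oo%E}.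
Proof.
move=> q0 n0 p_noninc; rewrite lq_norm1.
under eq_eseriesr do rewrite ger0_norm//.
move=> py.
have [[c [c0 cp]]|nc] := pselect (exists c, 0 < c /\ forall j, c <= p j).
  (* As [p j <= 1/2], one has [(1 - p j)^n >= 2^-n >= 2^-n * p j], so these probabilities inherit
     the divergence of the sum of [p]. *)
  have /ae_block_infinitely_often : (\sum_(0 <= j <oo) (pb false j ^+ n)%:E = +oo)%E.
    apply/eqP; rewrite -leye_eq.
    apply: (@le_trans _ _ (\sum_(0 <= j <oo) ((2^-1 ^+ n)%:E * (p j)%:E))%E).
      rewrite nneseriesZl; last by move=> j _; rewrite lee_fin.
      rewrite py gt0_muley// lte_fin exprn_gt0//; lra.
    apply: lee_nneseries => [j _ _|j _].
      by rewrite mule_ge0// lee_fin// exprn_ge0//; lra.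
    have := p_range j => pj.
    have h : 2^-1 ^+ n <= (1 - p j) ^+ n :> R by rewrite lerXn2r// ?nnegrE; lra.
    rewrite -EFinM lee_fin /pb; apply: le_trans h; apply: ler_piMr; last by lra.
    by apply: exprn_ge0; lra.
  apply: filterS => w wy.
  apply: (@lq_norm_pinfty _ _ _ (fun j => w \in block false n j) 0%N c _ _ wy) => // j _.
  rewrite inE => wj; rewrite devE big1; last first.
    move=> i _; rewrite indicE memNset// => wt.
    have wf : (X i w : nat -> bool) j = false := wj i (ltn_ord i).
    have : (X i w : nat -> bool) j = true := wt.
    by rewrite wf.
  by rewrite mulr0 sub0r normrN ger0_norm.
have e0 : 0 < (2 * n%:R)^-1 :> R by rewrite invr_gt0 mulr_gt0// ltr0n.
have [N pN] : exists N, p N < (2 * n%:R)^-1.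
  apply/not_existsP => H; apply: nc; exists (2 * n%:R)^-1; split => // j.
  by rewrite leNgt; apply/negP; exact: H.
(* Monotonicity of [p] extends the bound from [N] to all later indices. *)
have {}pN j : (N <= j)%N -> p j < (2 * n%:R)^-1.
  by move=> Nj; apply: le_lt_trans pN; move/nonincreasing_seqP : p_noninc; exact.
(* Only the first sample is constrained, so the block has probability [p j] and the divergence is
   the hypothesis itself. *)
have /ae_block_infinitely_often : (\sum_(0 <= j <oo) (pb true j ^+ 1)%:E = +oo)%E.
  by rewrite -py; apply: eq_eseriesr => j _; rewrite expr1.
apply: filterS => w wy.
apply: (@lq_norm_pinfty _ _ _ (fun j => w \in block true 1 j) N (2 * n%:R)^-1 _ _ wy)
  => // j Nj.
rewrite inE => wj; rewrite devE.
case: n n0 {e0 nc} pN => // n _ /(_ _ Nj) pj.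
rewrite big_ord_recl indicE mem_set; last exact: wj.
set s := \sum_(i < n) _.
have s0 : 0 <= s by rewrite sumr_ge0.
apply: le_trans (ler_norm _).
(* With [e] half the weight of one sample, the deviation is at least [2 e - p j >= e]; the other
   samples only add the nonnegative term in [s]. *)
have nV : n.+1%:R^-1 = 2 * (2 * n.+1%:R)^-1 :> R.
  by field; rewrite ?pnatr_eq0.
have : 0 <= n.+1%:R^-1 * s by rewrite mulr_ge0.
rewrite mulrDr mulr1 nV; move: pj; set e := (2 * n.+1%:R)^-1.
by set t := _ * s; lra.
Qed.
End product_sample.

(** * Combination of the convergent and the divergent case *)

Theorem proposition7 (R : realType) (q : R) (p : nat -> R)
    (d : measure_display) (T : measurableType d) (P : probability T R)
    (mu : probability bitseqs R) (X : nat -> {RV P >-> bitseqs})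
    (q_ge1 : 1 <= q)
    (p_range : forall j : nat, 0 <= p j <= 2^-1)
    (p_noninc : forall j : nat, p j.+1 <= p j)
    (mu_prod : is_product_bernoulli p mu)
    (X_iid : iid_samples mu X) :
  let err (n : nat) (w : T) : \bar R :=
    lq_norm q (fun j : nat => empirical_mean X n w j - p j) in
  ((\int[P]_w err n w)%E @[n --> \oo] --> 0%E <->
    (lq_norm 1 p < +oo)%E) /\
  (lq_norm 1 p = +oo%E ->
    forall n : nat, (0 < n)%N -> {ae P, forall w, err n w = +oo%E}).
Proof.
move=> err; have q0 : 0 < q by lra.
have erry : lq_norm 1 p = +oo%E ->
    forall n : nat, (0 < n)%N -> {ae P, forall w, err n w = +oo%E}.
  by move=> py n n0; exact: (@ae_lq_norm_dev_pinfty _ _ _ _ _ _ _ p_range mu_prod X_iid).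
split=> //; split=> [cvg_err|py]; last first.
  exact: (@cvg_mean_lq_norm_dev _ _ _ _ _ _ _ p_range mu_prod X_iid).
rewrite ltey; apply/negP => /eqP /erry {}erry.
(* The index 0 is excluded: there the empirical mean is 0 and [err 0] is the q-norm of [p], which
   can be finite when [q > 1]. *)
have int_err n : (0 < n)%N -> (\int[P]_w err n w = +oo)%E.
  move=> n0; rewrite (ae_eq_integral (cst +oo%E))//.
  - by rewrite integral_cst// [X in (_ * X)%E]probability_setT mule1.
  - apply: measurable_lq_norm => // j.
    exact: measurable_dev.
  - by apply: filterS (erry n n0) => w ? _.
(* The expectations are eventually constant equal to [+oo], so uniqueness of limits contradicts
   convergence to 0. *)
suff : (0 = +oo :> \bar R)%E by [].
apply: cvg_unique cvg_err _ => //.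
apply: cvg_near_cst; near=> n; rewrite int_err//.
by near: n; exact: nbhs_infty_gt.
Unshelve. all: by end_near. Qed.
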